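(* (1) There exists a $q$-Steiner system $S_2[2,3,13]$, i.e. a set $\mathcal{B}$ of $3$-dimensional subspaces of $\mathbb{F}_2^{13}$ such that every $2$-dimensional subspace of $\mathbb{F}_2^{13}$ is contained in exactly one element of $\mathcal{B}$. (2) There exists a Steiner system $S(3,8,8192)$, i.e. a set $X$ with $|X|=8192$ together with a collection of $8$-element subsets of $X$ (blocks) such that every $3$-element subset of $X$ is contained in exactly one block. (3) $A_2(13,4,3)=1597245$.
   Context: For a prime power $q$ and integers $1\le t\le k\le n$, a $q$-Steiner system $S_q[t,k,n]$ is a set $\mathcal{B}$ of $k$-dimensional subspaces of $\mathbb{F}_q^n$ such that every $t$-dimensional subspace of $\mathbb{F}_q^n$ is contained in exactly one element of $\mathcal{B}$. The subspace distance between subspaces $U,V$ of $\mathbb{F}_q^n$ is $d(U,V)=\dim U+\dim V-2\dim(U\cap V)$. A constant dimension code in $\mathbb{F}_q^n$ of dimension $k$ and minimum subspace distance $d$ is a set of $k$-dimensional subspaces of $\mathbb{F}_q^n$ any two distinct members of which have subspace distance at least $d$. $A_q(n,d,k)$ denotes the maximum number of codewords of such a code. *)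

(* Defs.v *)
From HB Require Import structures.
From mathcomp Require Import all_boot all_order all_algebra.

Set Implicit Arguments.
Unset Strict Implicit.
Unset Printing Implicit Defensive.

(* {vspace vT} is a subtype of a matrix type, so it is finite over a finite
   field; the library has no finType instance for it. *)
Section FiniteVspace.
Import VectorInternalTheory.
Variables (F : finFieldType) (vT : vectType F).

HB.instance Definition _ := [Countable of {vspace vT} by <:].
HB.instance Definition _ := [Finite of {vspace vT} by <:].

End FiniteVspace.

Definition q_steiner_system (F : finFieldType) (t k n : nat)
    (B : {set {vspace 'rV[F]_n}}) : Prop :=
  [/\ [&& 1 <= t, t <= k & k <= n],
      forall U, U \in B -> \dim U = k
    & forall T : {vspace 'rV[F]_n}, \dim T = t ->
        exists! U, U \in B /\ (T <= U)%VS].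

Definition steiner_system (t k v : nat) (X : finType) (B : {set {set X}}) :
    Prop :=
  [/\ #|X| = v,
      forall b, b \in B -> #|b| = k
    & forall T : {set X}, #|T| = t -> exists! b, b \in B /\ T \subset b].

(* Subtraction on nat loses nothing here: \dim (U :&: V) is at most
   both \dim U and \dim V. *)
Definition subspace_dist (F : finFieldType) (n : nat)
    (U V : {vspace 'rV[F]_n}) : nat :=
  \dim U + \dim V - 2 * \dim (U :&: V)%VS.

Definition constant_dim_code (F : finFieldType) (n d k : nat)
    (C : {set {vspace 'rV[F]_n}}) : bool :=
  [forall U in C, \dim U == k] &&
  [forall U in C, forall V in C, (U != V) ==> (d <= subspace_dist U V)].

(* A_q(n,d,k), with q = #|F|. *)
Definition max_code_size (F : finFieldType) (n d k : nat) : nat :=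
  \max_(C : {set {vspace 'rV[F]_n}} | constant_dim_code d k C) #|C|.

(* Main.v *)
(* Write F_2^13 minus 0 as the powers of a primitive element of GF(2^13); the
   Singer cycle (multiplication by that element) together with the Frobenius
   map generates a group of order 8191 * 13, and 15 orbits of planes under this
   group form the q-Steiner system.  The exponents of the points of a plane that
   lies in such an orbit are base-block entries modulo 8191, shifted by a
   constant, so "every pair of points lies in exactly one block" says that the
   8190 = 15 * 13 * 42 differences within the base blocks exhaust the nonzero
   residues modulo 8191; this and the fact that the 15 representatives are
   planes are checked by computation.  The affine translates of the blocks give
   S(3, 8, 2^13).  Planes at distance at least 4 share no pair of points, so
   counting the 42 ordered pairs of each plane bounds a code by
   8191 * 8190 / 42, with equality for the q-Steiner system. *)
From Stdlib Require Import NArith.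
Require Import Defs.
From mathcomp Require Import all_boot all_order all_algebra.
From mathcomp Require Import finfield zify.

Set Implicit Arguments.
Unset Strict Implicit.
Unset Printing Implicit Defensive.

Import GRing.Theory.
Local Open Scope ring_scope.

(** * Pairs of vectors covered by 3-dimensional subspaces over F_2 *)

Section PairDesigns.
Variable n : nat.
Local Notation V := 'rV['F_2]_n.
Implicit Types (x y : V) (U W : {vspace V}) (B C : {set {vspace V}}).

Lemma card_vspaceF2 W : #|W| = (2 ^ \dim W)%N.
Proof. by rewrite card_vspace card_Fp. Qed.

(** Over F_2 distinct nonzero vectors are independent, so these are the ordered bases of the
    2-dimensional subspaces of [W]. *)
Definition pairs W : {set V * V} :=
  [set p | [&& p.1 != 0, p.2 != 0, p.1 != p.2, p.1 \in W & p.2 \in W]].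

Lemma card_pairs W : #|pairs W| = ((2 ^ \dim W - 1) * (2 ^ \dim W - 2))%N.
Proof.
pose S := [set x in W | x != 0].
have cardS : #|S| = (2 ^ \dim W - 1)%N.
  have -> : S = [set x in W] :\ 0.
    by apply/setP => x; rewrite !inE andbC.
  rewrite -card_vspaceF2 -(cardsE (mem W)).
  by rewrite [in RHS](cardsD1 0) inE mem0v addKn.
have -> : pairs W = setX S S :\: [set (x, x) | x in S].
  apply/setP => -[x y]; rewrite !inE /=.
  have -> : ((x, y) \in [set (z, z) | z in S]) = (x == y) && (x \in S).
    by apply/imsetP/andP => [[z zS [-> ->]] | [/eqP <- xS]]; last exists x.
  rewrite !inE /=; case: (eqVneq x y) => [->|_]; last first.
    by case: (x == 0); case: (y == 0); case: (x \in W); case: (y \in W).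
  by case: (y == 0); case: (y \in W).
have diagS : [set (x, x) | x in S] \subset setX S S.
  by apply/subsetP => _ /imsetP[x xS ->]; rewrite inE /= xS.
rewrite cardsD (setIidPr diagS) cardsX card_imset; last by move=> x y [].
by rewrite cardS; nia.
Qed.

(** Two 3-dimensional subspaces have distance at least 4 exactly when they meet in dimension at most
    1; this turns the code condition into disjointness of pair sets. *)
Lemma pairs_eq0 W : (pairs W == set0) = (\dim W <= 1)%N.
Proof.
rewrite -cards_eq0 card_pairs muln_eq0; case: (\dim W) => [|[|d]] //.
have := expn_gt0 2 d; rewrite !expnS; lia.
Qed.

Lemma pairsI U W : pairs (U :&: W) = pairs U :&: pairs W.
Proof.
apply/setP => p; rewrite !inE !memv_cap.
by case: (_ != 0); case: (_ != 0); case: (_ != _) => //=;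
  case: (_ \in U); case: (_ \in W); case: (_ \in U).
Qed.

Definition covers_pairs B : Prop :=
  [/\ forall U, U \in B -> \dim U = 3%N
    & forall p, p \in pairs fullv -> exists! U, U \in B /\ p \in pairs U].

Lemma constant_dim_code_pairs C :
  constant_dim_code 4 3 C ->
  [/\ forall U, U \in C -> \dim U = 3%N
    & forall U W p, U \in C -> W \in C -> p \in pairs U -> p \in pairs W ->
      U = W].
Proof.
case/andP => /forall_inP dimC /forall_inP distC.
split=> [U UC|U W p UC WC pU pW]; first exact/eqP/dimC.
apply/eqP; apply: contraT => neUW.
have /forall_inP/(_ W WC) := distC U UC; rewrite neUW /= /subspace_dist.
rewrite (eqP (dimC U UC)) (eqP (dimC W WC)) => dist4.
have dimUW d : (4 <= 3 + 3 - 2 * d -> d <= 1)%N by lia.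
have: pairs (U :&: W) == set0 by rewrite pairs_eq0 dimUW.
by rewrite pairsI => /eqP/setP/(_ p); rewrite in_setI pU pW inE.
Qed.

Lemma covers_pairs_code B : covers_pairs B -> constant_dim_code 4 3 B.
Proof.
case=> dimB covB; apply/andP; split; apply/forall_inP => U UB.
  by rewrite dimB.
apply/forall_inP => W WB; apply/implyP => neUW; rewrite /subspace_dist.
have distUW d : (d <= 1 -> 4 <= 3 + 3 - 2 * d)%N by lia.
rewrite (dimB U UB) (dimB W WB); apply: distUW.
rewrite -pairs_eq0 pairsI; apply: contraT => /set0Pn[p /setIP[pU pW]].
have [|X [_ uniqX]] := covB p.
  by move: pU; rewrite !inE !memvf => /and3P[-> -> /and3P[->]].
by rewrite -(uniqX U) // -(uniqX W) ?eqxx in neUW.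
Qed.

(** Incidences between subspaces and pairs are counted from both sides; each subspace contributes 7
    * 6 = 42 pairs. *)
Lemma double_count C : (forall U, U \in C -> \dim U = 3%N) ->
  (#|C| * 42 = \sum_(p in pairs fullv) #|[set U in C | p \in pairs U]|)%N.
Proof.
move=> dimC; under eq_bigr do rewrite -sum1_card.
rewrite -sum_nat_const (exchange_big_dep (mem C)) /=; last first.
  by move=> p U _; rewrite inE => /andP[].
apply: eq_bigr => U UC; rewrite sum1_card.
transitivity #|pairs U|; first by rewrite card_pairs dimC.
apply: eq_card => p; rewrite [RHS]inE /= !inE UC !memvf /=.
by case: (_ != 0); case: (_ != 0); case: (_ != _).
Qed.

Lemma card_code C : constant_dim_code 4 3 C ->
  (#|C| * 42 <= (2 ^ n - 1) * (2 ^ n - 2))%N.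
Proof.
case/constant_dim_code_pairs => dimC uniqC; rewrite double_count //.
have -> : ((2 ^ n - 1) * (2 ^ n - 2) = \sum_(p in pairs fullv) 1)%N.
  by rewrite sum1_card card_pairs dimvf /dim /= mul1n.
apply: leq_sum => p _; apply/card_le1_eqP => U W.
move=> /setIdP[UC pU] /setIdP[WC pW]; exact: (uniqC W U p).
Qed.

Lemma card_covers_pairs B : covers_pairs B ->
  (#|B| * 42 = (2 ^ n - 1) * (2 ^ n - 2))%N.
Proof.
case=> dimB covB; rewrite double_count //.
have -> : ((2 ^ n - 1) * (2 ^ n - 2) = \sum_(p in pairs fullv) 1)%N.
  by rewrite sum1_card card_pairs dimvf /dim /= mul1n.
apply: eq_bigr => p /covB[U [[UB pU] uniqU]].
apply/eqP/cards1P; exists U; apply/setP => W.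
by apply/setIdP/set1P => [[WB pW]|->//]; rewrite (uniqU W).
Qed.

Lemma max_code_size_covers_pairs B : covers_pairs B ->
  max_code_size 'F_2 n 4 3 = #|B|.
Proof.
move=> covB; apply/eqP; rewrite eqn_leq; apply/andP; split.
  apply/bigmax_leqP => C /card_code.
  by rewrite -(card_covers_pairs covB) leq_pmul2r.
exact/leq_bigmax_cond/covers_pairs_code.
Qed.

Lemma dim2_span T : \dim T = 2%N ->
  exists2 p : V * V, p \in pairs fullv & T = <<[:: p.1; p.2]>>%VS.
Proof.
move=> dimT; have := vbasisP T; case: (vbasis T) => s /=.
rewrite dimT; case: s => [|x [|y [|]]] // _ /andP[/eqP spanT].
rewrite !free_cons span_nil span_seq1 memv0 => /and3P[xNy y0 _].
exists (x, y); last by rewrite spanT.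
rewrite inE /= y0 !memvf /= andbT; apply/andP; split.
  by apply: contraNneq xNy => ->; rewrite mem0v.
by apply: contraNneq xNy => ->; rewrite memv_line.
Qed.

Lemma covers_pairs_q_steiner B :
  (3 <= n)%N -> covers_pairs B -> q_steiner_system 2 3 B.
Proof.
move=> n3 [dimB covB]; split=> // T /dim2_span[p pV ->].
have subT U : (<<[:: p.1; p.2]>> <= U)%VS = (p \in pairs U).
  move: pV; rewrite span_cons span_seq1 subv_add -!memvE !inE.
  by case/and3P => -> -> /andP[->].
have [U [UB uniqU]] := covB p pV; exists U.
by split=> [|W]; rewrite subT //; exact: uniqU.
Qed.

Definition coset x U : {set V} := [set y | y - x \in U].

Lemma coset_eq x y U : y \in coset x U -> coset y U = coset x U.
Proof.
rewrite inE => yx; apply/setP => z; rewrite !inE; apply/idP/idP => zU.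
  by have -> : z - x = (z - y) + (y - x) by [rewrite addrA subrK]; apply: memvD.
have -> : z - y = (z - x) - (y - x) by rewrite opprB addrA subrK.
exact: memvB.
Qed.

(** Translating x to 0, the triple {x, y, z} lies in x + U exactly when the pair (y - x, z - x) lies
    in U. Every block through x can be rebased at x, so uniqueness carries over too. *)
Lemma covers_pairs_steiner B : covers_pairs B ->
  steiner_system 3 8 (2 ^ n) [set coset p.1 p.2 | p in setX [set: V] B].
Proof.
case=> dimB covB; split.
- by rewrite card_mx card_Fp // mul1n.
- move=> _ /imsetP[[x U] /setXP[_ /= UB] ->].
  have -> : coset x U = [set x + u | u in U].
    apply/setP => y; rewrite inE; apply/idP/imsetP => [yx|[u uU ->]].
      by exists (y - x); rewrite // addrC subrK.
    by rewrite addrC addKr.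
  by rewrite card_imset ?card_vspaceF2 ?dimB //; exact: addrI.
move=> T cardT.
have /card_gt0P[x xT] : (0 < #|T|)%N by rewrite cardT.
have /eqP/cards2P[y [z [neyz Tyz]]] : #|T :\ x| = 2%N.
  by move: cardT; rewrite (cardsD1 x) xT => -[].
have [[neyx yT] [nezx zT]] : (y != x /\ y \in T) /\ (z != x /\ z \in T).
  have /setD1P yTx : y \in T :\ x by rewrite Tyz !inE eqxx.
  by have /setD1P : z \in T :\ x by rewrite Tyz !inE eqxx orbT.
pose p := (y - x, z - x).
have pE U : (p \in pairs U) = (T \subset coset x U).
  rewrite inE !subr_eq0 neyx nezx (inj_eq (addIr _)) neyz /=.
  apply/andP/subsetP => [[yU zU] t tT|sub]; last first.
    by have := sub y yT; have := sub z zT; rewrite !inE.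
  have [->|ntx] := eqVneq t x; first by rewrite inE subrr mem0v.
  have: t \in T :\ x by rewrite !inE ntx.
  by rewrite Tyz !inE => /orP[] /eqP ->.
have [|U [[UB pU] uniqU]] := covB p.
  by rewrite inE !memvf !subr_eq0 neyx nezx (inj_eq (addIr _)) neyz.
exists (coset x U); split.
  by split; rewrite -?pE //; apply/imsetP; exists (x, U); rewrite ?inE.
move=> _ [/imsetP[[w W] /setXP[_ /= WB] ->]] sub.
have xw : x \in coset w W by apply: (subsetP sub).
rewrite -(coset_eq xw) in sub *.
by rewrite (uniqU W) // pE.
Qed.

End PairDesigns.

(** * Explicit vectors over F_2 and their encoding as binary numbers *)

Lemma span3E n (u v w x : 'rV['F_2]_n) :
  (x \in <<[:: u; v; w]>>%VS) =
  (x \in [:: 0; u; v; u + v; w; u + w; v + w; u + v + w]).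
Proof.
rewrite !inE; apply/idP/idP.
  rewrite !span_cons span_nil addv0 => /memv_addP[_ /vlineP[a ->]].
  move=> [_ /memv_addP[_ /vlineP[b ->] [_ /vlineP[c ->] ->]] ->].
  have F2 (k : 'F_2) : k = 0 \/ k = 1.
    by case: k => -[|[|//]] lt_k2; [left | right]; apply: val_inj.
  by case: (F2 a) => ->; case: (F2 b) => ->; case: (F2 c) => ->;
    rewrite !(scale0r, scale1r, add0r, addr0) ?addrA eqxx ?orbT.
have [uS vS wS] : [/\ u \in <<[:: u; v; w]>>%VS, v \in <<[:: u; v; w]>>%VS
    & w \in <<[:: u; v; w]>>%VS].
  by split; apply: memv_span; rewrite !inE eqxx ?orbT.
by do 7?[case/orP]; move=> /eqP->; rewrite ?mem0v ?memvD.
Qed.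

(* [13825 = 2^13 + 2^12 + 2^10 + 2^9 + 1] encodes the primitive polynomial
   [X^13 + X^12 + X^10 + X^9 + 1]. *)
Definition step (a : N) : N :=
  if N.testbit a 12 then N.lxor (N.double a) 13825 else N.double a.

Definition vec (a : N) : 'rV['F_2]_13 :=
  \row_(j < 13) (N.testbit a (N.of_nat j))%:R.

(** Acts on row vectors from the right: row i < 12 sends X^i to X^(i+1), and the last row replaces
    X^13 by the lower terms of the polynomial. *)
Definition companion : 'M['F_2]_13 :=
  \matrix_(i, j) ((j == i.+1 :> nat) (+)
                  (i == 12 :> nat) && N.testbit 13825 (N.of_nat j))%:R.

Lemma natrF2_addb (a b : bool) : (a (+) b)%:R = a%:R + b%:R :> 'F_2.
Proof. by case: a; case: b; apply: val_inj. Qed.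

Lemma natrF2_andb (a b : bool) : (a && b)%:R = a%:R * b%:R :> 'F_2.
Proof. by case: a; case: b; apply: val_inj. Qed.

Lemma testbit_lxor a b j :
  N.testbit (N.lxor a b) j = N.testbit a j (+) N.testbit b j.
Proof. by rewrite N.lxor_spec; case: (N.testbit a j). Qed.

Lemma vec_lxor a b : vec (N.lxor a b) = vec a + vec b.
Proof. by apply/rowP => j; rewrite !mxE testbit_lxor natrF2_addb. Qed.

Lemma testbit_step a j : N.testbit (step a) j =
  N.testbit (N.double a) j (+) (N.testbit a 12 && N.testbit 13825 j).
Proof.
rewrite /step; case: (N.testbit a 12); last by rewrite addbF.
by rewrite testbit_lxor.
Qed.

Lemma vec_step a : vec (step a) = vec a *m companion.
Proof.
apply/rowP => j; rewrite !mxE testbit_step natrF2_addb natrF2_andb.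
have -> : \sum_i vec a 0 i * companion i j =
    \sum_(i < 13) (vec a 0 i * (j == i.+1 :> nat)%:R +
     vec a 0 i * ((i == ord_max) && N.testbit 13825 (N.of_nat j))%:R).
  by apply: eq_bigr => i _; rewrite -mulrDr [companion _ _]mxE natrF2_addb.
rewrite big_split /=; congr (_ + _); last first.
  rewrite (bigD1 ord_max) //= mxE /= big1 ?addr0 // => i /negPf->.
  by rewrite mulr0.
case: j => -[|j] ltj13 /=.
  by rewrite N.double_spec N.testbit_even_0 big1 // => i _; rewrite mulr0.
have -> : N.testbit (N.double a) (N.of_nat j.+1) = N.testbit a (N.of_nat j).
  by rewrite Nnat.Nat2N.inj_succ N.double_bits_succ.
rewrite (bigD1 (Ordinal (ltnW ltj13))) //= eqxx mulr1 mxE big1 ?addr0 // => i.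
by rewrite -val_eqE /= eqSS eq_sym => /negPf->; rewrite mulr0.
Qed.

(** * Powers of the primitive element: the orbit of 1 under the Singer cycle *)

Definition pw (i : nat) : 'rV['F_2]_13 := vec 1 *m companion ^+ i.

Lemma pw0 : pw 0 = vec 1.
Proof. by rewrite /pw expr0 mulmx1. Qed.

Lemma pwD i j : pw (i + j) = pw i *m companion ^+ j.
Proof. by rewrite /pw exprD -mulmxE mulmxA. Qed.

Lemma pw_iter e : pw (N.to_nat e) = vec (N.iter e step 1%num).
Proof.
rewrite Nnat.N2Nat.inj_iter; elim: (N.to_nat e) => [|i IHi] /=.
  exact: pw0.
by rewrite vec_step -IHi -[companion]expr1 -pwD addn1.
Qed.

(** Going through [N] keeps the literal binary, in a form that [lia] can read. *)
Definition singer_order : nat := N.to_nat 8191.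

Lemma singer_orderE : singer_order = (2 ^ 13 - 1)%N.
Proof. by rewrite /singer_order; lia. Qed.

Lemma prime_singer_order : prime singer_order.
Proof. by vm_compute. Qed.

Lemma singer_order_gt0 : (0 < singer_order)%N.
Proof. exact: prime_gt0 prime_singer_order. Qed.

Lemma pw_singer_order : pw singer_order = pw 0.
Proof.
have step_order : N.iter 8191 step 1%num = 1%num by vm_compute.
by rewrite pw0 /singer_order pw_iter step_order.
Qed.

Lemma pw_period i j : i = j %[mod singer_order] -> pw i = pw j.
Proof.
have pwM k l : pw (k * singer_order + l) = pw l.
  elim: k => [|k IHk] //.
  by rewrite mulSn -addnA pwD pw_singer_order -pwD add0n.
move=> eq_ij; rewrite (divn_eq i singer_order) (divn_eq j singer_order).
by rewrite !pwM eq_ij.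
Qed.

(** A shift by k is undone by a further shift that completes it to a multiple of the period. *)
Lemma pw_eq_add k i j : pw (i + k) = pw (j + k) -> pw i = pw j.
Proof.
move=> eq_ij.
have pwK l : pw l = pw (l + k) *m companion ^+ (k * singer_order - k).
  rewrite -pwD; apply: pw_period.
  by rewrite -addnA subnKC ?leq_pmulr ?singer_order_gt0 // addnC modnMDl.
by rewrite pwK eq_ij -pwK.
Qed.

(** Since 8191 is prime, a return time d not divisible by it is coprime to it; Bezout then makes 1 a
    return time, which is false. *)
Lemma pw_eq0_dvdn d : pw d = pw 0 -> (singer_order %| d)%N.
Proof.
move=> pwd; apply: contraT.
rewrite -(prime_coprime d prime_singer_order) coprime_sym => cop.
have pwM k : pw (k * d) = pw 0.
  by elim: k => // k IHk; rewrite mulSn pwD pwd -pwD add0n.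
have d_gt0 : (0 < d)%N.
  by case: d cop {pwd pwM} => //; rewrite /coprime gcd0n.
case: (egcdnP singer_order d_gt0) => u v /= def_uv _.
have: pw 1 = pw 0.
  rewrite -(pwM u) def_uv (eqP cop); apply: pw_period.
  by rewrite modnMDl.
(* The encodings are 2 and 1, which differ in bit 0. *)
rewrite (pw_iter 1) pw0 => /rowP/(_ ord0).
by rewrite !mxE.
Qed.

Lemma pw_inj i j : pw i = pw j -> i = j %[mod singer_order].
Proof.
wlog le_ij : i j / (i <= j)%N => [hw eq_ij|].
  by case/orP: (leq_total i j) => /hw le; [apply: le|apply/esym/le].
rewrite -{1}[i]add0n -{1}(subnK le_ij) => /pw_eq_add /esym /pw_eq0_dvdn.
by move=> dvd; apply/esym/eqP; rewrite eqn_mod_dvd.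
Qed.

Lemma pw_neq0 i : pw i != 0.
Proof.
have pw0n : pw 0 != 0.
  by apply/eqP; rewrite pw0 => /rowP/(_ ord0); rewrite !mxE.
apply: contra_neq pw0n => pwi0.
(* A vanishing power would stay zero until the orbit returns to [pw 0]. *)
have -> : pw 0 = pw (i + (i * singer_order - i)).
  apply: pw_period; rewrite subnKC ?leq_pmulr ?singer_order_gt0 //.
  by rewrite modnMl mod0n.
by rewrite pwD pwi0 mul0mx.
Qed.

(** The first 8191 powers are distinct and nonzero, and there are only 2^13 - 1 nonzero vectors. *)
Lemma pw_surj x : x != 0 -> exists i, x = pw i.
Proof.
suff /eqP im : [set pw i | i : 'I_singer_order] == [set~ 0].
  by rewrite -in_setC1 -im => /imsetP[i _ ->]; exists i.
rewrite eqEcard; apply/andP; split.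
  by apply/subsetP => _ /imsetP[i _ ->]; rewrite !inE pw_neq0.
rewrite card_imset; last first.
  move=> i j /pw_inj; rewrite !modn_small // => eq_ij; exact: val_inj.
rewrite card_ord cardsC1 card_mx card_Fp // mul1n singer_orderE subn1.
Qed.

(** * Collinear points and the Frobenius map *)

Definition pw_line a b c : Prop :=
  forall i, pw (i + a) + pw (i + b) = pw (i + c).

(** Multiplying by a power of the companion matrix shifts all exponents at once; [pw_line_double]
    combines several such shifts. *)
Lemma pw_line0 a b c : pw a + pw b = pw c -> pw_line a b c.
Proof. by move=> abc i; rewrite ![(i + _)%N]addnC !pwD -mulmxDl abc. Qed.

Lemma addrr_F2 n (x : 'rV['F_2]_n) : x + x = 0.
Proof.
by apply/rowP => j; rewrite !mxE; case: (x 0 j) => -[|[|//]] lt; apply: val_inj.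
Qed.

(* With T the companion matrix: (T^a + T^b)^2 = T^2a + T^2b in
   characteristic 2. *)
Lemma pw_line_double a b c :
  pw_line a b c -> pw_line (a * 2) (b * 2) (c * 2).
Proof.
move=> abc i; rewrite !muln2 -!addnn !addnA -[RHS]abc.
rewrite ![(i + c + _)%N]addnAC -!abc [(i + b + a)%N]addnAC addrA.
by rewrite -[_ + _ + pw (i + a + b)]addrA addrr_F2 addr0.
Qed.

Lemma pw_line_pow2 m a b c :
  pw_line a b c -> pw_line (a * 2 ^ m) (b * 2 ^ m) (c * 2 ^ m).
Proof.
move=> abc; elim: m => [|m IHm]; first by rewrite !muln1.
by rewrite expnSr !mulnA; apply: pw_line_double.
Qed.

(* Exponents of the nonzero vectors of the 15 orbit representatives, the
   vectors being listed in the order u, v, u + v, w, u + w, v + w, u + v + w. *)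
Definition representatives : seq (seq N) :=
 [::
     [:: 0; 1; 7258; 1249; 8105; 5040; 7978];
     [:: 0; 7; 6681; 1857; 7259; 7381; 7908];
     [:: 0; 9; 7714; 1144; 1945; 8102; 6771];
     [:: 0; 11; 1941; 209; 3565; 6579; 2926];
     [:: 0; 12; 3696; 2181; 6673; 6965; 2519];
     [:: 0; 13; 8110; 4821; 8052; 5178; 7823];
     [:: 0; 17; 5132; 291; 1199; 8057; 6266];
     [:: 0; 20; 3996; 1075; 7313; 4776; 3939];
     [:: 0; 21; 6087; 2900; 4915; 4226; 8008];
     [:: 0; 27; 3572; 1190; 6710; 4989; 5199];
     [:: 0; 30; 682; 141; 6256; 6406; 2024];
     [:: 0; 31; 1243; 814; 4434; 1161; 6254];
     [:: 0; 37; 5396; 258; 6469; 2093; 4703];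
     [:: 0; 115; 1272; 949; 4539; 4873; 1580];
     [:: 0; 119; 6670; 490; 6812; 7312; 5941]]%num.

(* The Frobenius map doubles exponents. *)
Definition base : seq (seq N) :=
  [seq [seq ((e * 2 ^ N.of_nat m) mod 8191)%num | e <- b]
     | b <- representatives, m <- iota 0 13].

(** * The base blocks as a difference family *)

Definition exponent (b : seq N) (i : nat) : nat := N.to_nat (nth 0%num b i).

Definition offdiag : seq (nat * nat) :=
  [seq p <- [seq (i, j) | i <- iota 0 7, j <- iota 0 7] | p.1 != p.2].

Definition difference (t : seq N * (nat * nat)) : N :=
  let e := nth 0%num t.1 t.2.1 in let f := nth 0%num t.1 t.2.2 in
  if N.leb e f then N.sub f e else N.sub (f + 8191) e.

Definition base_pairs : seq (seq N * (nat * nat)) :=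
  [seq (b, p) | b <- base, p <- offdiag].

(** Every nonzero residue modulo 8191 is a difference exactly once. Sorting reduces this to one
    computed equality of lists. *)
Lemma perm_differences :
  perm_eq [seq difference t | t <- base_pairs]
          [seq N.of_nat d | d <- iota 1 (N.to_nat 8190)].
Proof.
have sorted_differences : sort N.leb [seq difference t | t <- base_pairs] =
    [seq N.of_nat d | d <- iota 1 (N.to_nat 8190)] by vm_compute.
by rewrite -sorted_differences perm_sym perm_sort perm_refl.
Qed.

Lemma mem_offdiag i j :
  ((i, j) \in offdiag) = [&& (i < 7)%N, (j < 7)%N & i != j].
Proof.
rewrite mem_filter [(i, j).1]/= [(i, j).2]/= [RHS]andbA [RHS]andbC; congr andb.
apply/allpairsP/andP => [[p [ip jp [-> ->]]]|[lt_i7 lt_j7]].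
  by move: ip jp; rewrite !mem_iota.
by exists (i, j); rewrite !mem_iota.
Qed.

Lemma exponent_lt b i : b \in base -> (exponent b i < singer_order)%N.
Proof.
case/allpairsP => -[r m] [_ _ ->]; rewrite /exponent /singer_order.
(* Out of range, the default exponent 0 satisfies the bound as well. *)
have [ltis|leis] := ltnP i (size r); last first.
  by rewrite nth_default ?size_map //; lia.
rewrite (nth_map 0%num) //=.
have := N.mod_lt (nth 0%num r i * 2 ^ N.of_nat m) 8191; lia.
Qed.

Lemma difference_mod b i j : b \in base ->
  exponent b i + N.to_nat (difference (b, (i, j))) = exponent b j
    %[mod singer_order].
Proof.
move=> bB; have := exponent_lt i bB; have := exponent_lt j bB.
rewrite /exponent /difference /=.
set e := nth _ b i; set f := nth _ b j => lt_f lt_e.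
case: N.leb_spec => le_ef; first by congr (_ %% _)%N; lia.
have -> : (N.to_nat e + N.to_nat (f + 8191 - e) = singer_order + N.to_nat f)%N.
  by rewrite /singer_order in lt_e *; lia.
by rewrite modnDl.
Qed.

(** Entries 0, 1 and 3 are the generators u, v and w; the four equations determine the other
    entries. *)
Definition is_plane (b : seq N) : bool :=
  let p i := N.iter (nth 0%num b i) step 1%num in
  [&& N.lxor (p 0%N) (p 1%N) == p 2%N, N.lxor (p 0%N) (p 3%N) == p 4%N,
      N.lxor (p 1%N) (p 3%N) == p 5%N & N.lxor (p 2%N) (p 3%N) == p 6%N].

Definition collinear b i j k :=
  pw_line (exponent b i) (exponent b j) (exponent b k).

Definition plane b :=
  [/\ collinear b 0 1 2, collinear b 0 3 4, collinear b 1 3 5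
    & collinear b 2 3 6].

Lemma representatives_plane b : b \in representatives -> plane b.
Proof.
have /allP planes : all is_plane representatives by vm_compute.
by move=> /planes/and4P[]; split; apply: pw_line0;
  rewrite /exponent !pw_iter -vec_lxor; congr vec; apply/eqP.
Qed.

Lemma to_natM a b : N.to_nat (a * b) = (N.to_nat a * N.to_nat b)%N.
Proof. exact: Nnat.N2Nat.inj_mul. Qed.

Lemma to_natD a b : N.to_nat (a + b) = (N.to_nat a + N.to_nat b)%N.
Proof. exact: Nnat.N2Nat.inj_add. Qed.

Lemma to_nat_pow2 m : N.to_nat (2 ^ N.of_nat m) = (2 ^ m)%N.
Proof.
elim: m => // m IHm.
by rewrite Nnat.Nat2N.inj_succ N.pow_succ_r' to_natM IHm expnS.
Qed.

(** Only the representatives are checked by computation; Frobenius preserves collinearity, and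
    reducing exponents modulo the period leaves the points unchanged. *)
Lemma base_plane b : b \in base -> plane b.
Proof.
case/allpairsP => -[r m] [rR _ -> /=].
have exponent_mul i :
  exponent [seq ((e * 2 ^ N.of_nat m) mod 8191)%num | e <- r] i =
  exponent r i * 2 ^ m %[mod singer_order].
  rewrite /exponent; have [ltir|leri] := ltnP i (size r); last first.
    by rewrite !nth_default ?size_map.
  rewrite (nth_map 0%num) // -to_nat_pow2 -to_natM.
  set e := (_ * _)%num.
  by rewrite [in RHS](N.div_mod e 8191) // to_natD to_natM mulnC modnMDl.
have lineM i j k : collinear r i j k ->
  collinear [seq ((e * 2 ^ N.of_nat m) mod 8191)%num | e <- r] i j k.
  move=> /(pw_line_pow2 m) line l; have := line l.
  by congr (_ + _ = _); apply/esym/pw_period;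
    rewrite -modnDmr exponent_mul modnDmr.
by case: (representatives_plane rR); split; apply: lineM.
Qed.

(** * Singer translates of the base blocks and the covering property *)

Definition block (b : seq N) (k : nat) : {vspace 'rV['F_2]_13} :=
  <<[:: pw (k + exponent b 0); pw (k + exponent b 1);
        pw (k + exponent b 3)]>>%VS.

(** [span3E] lists the span in the order of the block entries, so the four collinearities identify
    the two lists. *)
Lemma mem_block b k x : b \in base -> (x \in block b k) =
  (x \in 0 :: [seq pw (k + exponent b i) | i <- iota 0 7]).
Proof.
by move=> /base_plane[l2 l4 l5 l6]; rewrite span3E /= -l6 -l5 -l4 -!l2.
Qed.

Lemma block_nz b k x : b \in base -> x != 0 -> x \in block b k ->
  exists2 i, (i < 7)%N & x = pw (k + exponent b i).
Proof.
move=> bB x0; rewrite mem_block // inE (negPf x0) => /mapP[i].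
by rewrite mem_iota => /andP[_ i7] ->; exists i.
Qed.

Lemma pw_block b k i : b \in base -> (i < 7)%N ->
  pw (k + exponent b i) \in block b k.
Proof.
move=> bB i7; rewrite mem_block // inE; apply/orP; right.
by apply/mapP; exists i; rewrite // mem_iota.
Qed.

Lemma mem_base_pairs b i j : b \in base ->
  (i < 7)%N -> (j < 7)%N -> i != j -> (b, (i, j)) \in base_pairs.
Proof.
move=> bB i7 j7 ij; apply/allpairsP; exists (b, (i, j)); split=> //.
by rewrite mem_offdiag i7 j7.
Qed.

Lemma difference_bounds t : t \in base_pairs ->
  (0 < N.to_nat (difference t) < singer_order)%N.
Proof.
move=> tB; have : difference t \in [seq difference t | t <- base_pairs].
  exact: map_f.
rewrite (perm_mem perm_differences) => /mapP[d]; rewrite mem_iota => d_bd ->.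
rewrite Nnat.Nat2N.id /singer_order; lia.
Qed.

Lemma difference_surj d : (0 < d < singer_order)%N ->
  exists2 t, t \in base_pairs & N.to_nat (difference t) = d.
Proof.
rewrite /singer_order => d_bd.
have: N.of_nat d \in [seq difference t | t <- base_pairs].
  rewrite (perm_mem perm_differences); apply: map_f; rewrite mem_iota; lia.
by case/mapP => t tB eq_d; exists t; rewrite // -eq_d Nnat.Nat2N.id.
Qed.

Lemma uniq_map_inj (T1 T2 : eqType) (f : T1 -> T2) (s : seq T1) :
  uniq (map f s) -> {in s &, injective f}.
Proof.
elim: s => //= z s IHs /andP[fz uniq_s] x y; rewrite !inE.
move=> /predU1P[->|xs] /predU1P[->|ys] // eq_f.
- by case/mapP: fz; exists y.
- by case/mapP: fz; exists x.
exact: IHs.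
Qed.

(** A permutation of a duplicate-free list has no repetition; this is the source of uniqueness in
    the design. *)
Lemma difference_inj : {in base_pairs &, injective difference}.
Proof.
apply: uniq_map_inj; rewrite (perm_uniq perm_differences).
rewrite map_inj_uniq ?iota_uniq //; exact: Nnat.Nat2N.inj.
Qed.

Lemma block_period b k l : k = l %[mod singer_order] -> block b k = block b l.
Proof.
move=> kl; suff pwE i : pw (k + exponent b i) = pw (l + exponent b i).
  by rewrite /block !pwE.
by apply: pw_period; rewrite -modnDml kl modnDml.
Qed.

(** A coincidence of two points would produce the difference 0, which the computed list avoids. *)
Lemma pw_exponent_inj b k i j : b \in base -> (i < 7)%N -> (j < 7)%N ->
  pw (k + exponent b i) = pw (k + exponent b j) -> i = j.
Proof.
move=> bB i7 j7 eq_pw; apply/eqP; apply: contraT => ij.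
have /andP[d_gt0 lt_d] := difference_bounds (mem_base_pairs bB i7 j7 ij).
move/pw_inj/eqP: eq_pw; rewrite eqn_modDl => /eqP eq_e.
have /eqP := difference_mod i j bB.
rewrite -eq_e -[X in _ == X %[mod _]]addn0 eqn_modDl mod0n modn_small //.
by rewrite (gtn_eqF d_gt0).
Qed.

(** The dimension is read off from the cardinality: 0 and seven distinct nonzero points make 2^3
    vectors. *)
Lemma dim_block b k : b \in base -> \dim (block b k) = 3%N.
Proof.
move=> bB; apply/eqP; rewrite -(@eqn_exp2l 2) // -card_vspaceF2.
rewrite (eq_card (fun x => mem_block k x bB)).
apply/eqP; set l := _ :: _; suff /card_uniqP-> : uniq l by [].
rewrite cons_uniq map_inj_in_uniq ?iota_uniq ?andbT.
  apply/mapP => -[i _ pw0]; have := pw_neq0 (k + exponent b i).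
  by rewrite -pw0 eqxx.
by move=> i j; rewrite !mem_iota; apply: pw_exponent_inj.
Qed.

Definition design : {set {vspace 'rV['F_2]_13}} :=
  [set U | has (fun b => [exists k : 'I_singer_order, U == block b k]) base].

Lemma designP U :
  reflect (exists b k, b \in base /\ U = block b k) (U \in design).
Proof.
rewrite inE; apply: (iffP hasP) => [[b bB /existsP[k /eqP->]]|].
  by exists b, k.
case=> b [k [bB ->]]; exists b => //; apply/existsP.
exists (Ordinal (ltn_pmod k singer_order_gt0)); apply/eqP/block_period => /=.
by rewrite modn_mod.
Qed.

Lemma block_difference b k s t i j : b \in base ->
  pw i = pw (k + exponent b s) -> pw j = pw (k + exponent b t) ->
  i + N.to_nat (difference (b, (s, t))) = j %[mod singer_order].
Proof.
move=> bB /pw_inj eq_i /pw_inj eq_j.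
by rewrite -modnDml eq_i modnDml -addnA -modnDmr difference_mod // modnDmr.
Qed.

(** For x and y with exponents i and j, the residue j - i singles out a base block and two of its
    positions; matching the first position with i then fixes the shift modulo 8191. *)
Lemma design_covers_pairs : covers_pairs design.
Proof.
split=> [_ /designP[b [k [bB ->]]]|[x y]]; first exact: dim_block.
rewrite inE !memvf /= andbT => /and3P[x0 y0 nexy].
have [[i def_x] [j def_y]] := (pw_surj x0, pw_surj y0).
(* The added multiple of the period keeps the subtraction from truncating. *)
pose d := ((j + i * singer_order - i) %% singer_order)%N.
have lt_d : (d < singer_order)%N by rewrite ltn_pmod ?singer_order_gt0.
have id_j : i + d = j %[mod singer_order].
  have le_i : (i <= j + i * singer_order)%N.
    by rewrite (leq_trans _ (leq_addl _ _)) // leq_pmulr ?singer_order_gt0.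
  by rewrite modnDmr subnKC // addnC modnMDl.
have d_gt0 : (0 < d)%N.
  rewrite lt0n; apply: contraNneq nexy => d0.
  by rewrite def_x def_y; apply/eqP/pw_period; rewrite -id_j d0 addn0.
have eq_difference b k s t : b \in base ->
    x = pw (k + exponent b s) -> y = pw (k + exponent b t) ->
    (s < 7)%N -> (t < 7)%N ->
    (b, (s, t)) \in base_pairs /\ N.to_nat (difference (b, (s, t))) = d.
  move=> bB x_s y_t s7 t7.
  have stB : (b, (s, t)) \in base_pairs.
    apply: mem_base_pairs => //; apply: contraNneq nexy => st.
    by rewrite x_s y_t st.
  split=> //; have /andP[_ lt_d'] := difference_bounds stB.
  rewrite def_x in x_s; rewrite def_y in y_t.
  have /eqP := block_difference bB x_s y_t.
  by rewrite -id_j eqn_modDl !modn_small // => /eqP.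
have [|[b [s t]] tB def_d] := @difference_surj d; first by rewrite d_gt0.
have /allpairsP[[b' [s' t']] [bB + eq_t]] := tB.
case: eq_t bB => <- <- <- bB /=; rewrite mem_offdiag => /and3P[s7 t7 st].
have [k def_k] : exists k, k + exponent b s = i %[mod singer_order].
  (* This is i minus the exponent at s, again padded by a multiple of the period. *)
  exists (i + exponent b s * singer_order - exponent b s)%N.
  have le_e : (exponent b s <= i + exponent b s * singer_order)%N.
    by rewrite (leq_trans _ (leq_addl _ _)) // leq_pmulr ?singer_order_gt0.
  by rewrite subnK // addnC modnMDl.
have x_k : x = pw (k + exponent b s) by rewrite def_x; apply: pw_period.
have y_k : y = pw (k + exponent b t).
  rewrite def_y; apply: pw_period; rewrite -id_j -def_d -modnDml -def_k modnDml.
  by rewrite -addnA -modnDmr difference_mod // modnDmr.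
exists (block b k); split.
  split; first by apply/designP; exists b, k.
  by rewrite inE /= x0 y0 nexy {1}x_k y_k !pw_block.
move=> _ [/designP[c [l [cB ->]]]]; rewrite inE => /and5P[_ _ _ /= xU yU].
have [s2 s2_7 x_l] := block_nz cB x0 xU.
have [t2 t2_7 y_l] := block_nz cB y0 yU.
have [uB def_u] := eq_difference c l s2 t2 cB x_l y_l s2_7 t2_7.
(* Both blocks realise the residue d, so base block and positions agree. *)
have: difference (b, (s, t)) = difference (c, (s2, t2)).
  by apply: Nnat.N2Nat.inj; rewrite def_d def_u.
move/(difference_inj tB uB) => [eb es _]; subst c s2.
apply: block_period; rewrite x_k in x_l.
by move/pw_inj/eqP: x_l; rewrite eqn_modDr => /eqP.
Qed.

Close Scope ring_scope.

Theorem theorem1 :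
  [/\ exists B : {set {vspace 'rV['F_2]_13}}, q_steiner_system 2 3 B,
      exists (X : finType) (B : {set {set X}}), steiner_system 3 8 8192 B
    & max_code_size 'F_2 13 4 3 = 1597245].
Proof.
have coverB := design_covers_pairs; split.
- by exists design; apply: covers_pairs_q_steiner.
- exists 'rV['F_2]_13; eexists.
  have -> : 8192 = (2 ^ 13)%N by [].
  exact: covers_pairs_steiner coverB.
rewrite (max_code_size_covers_pairs coverB).
have := card_covers_pairs coverB.
(* The large literal is stored in decimal; unfolding it into ordinary products lets [lia] handle it
   without a unary expansion. *)
cbn [Nat.of_num_uint Nat.of_uint Nat.of_uint_acc].
rewrite !PeanoNat.Nat.tail_mul_spec; lia.
Qed.
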